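(* Let $X=\{X(t),\,t\in\mathcal{T}\}$ be a multifractal process with set of scales $\Lambda$, set $\mathcal{S}$ and family of scaling factors $\{M(\lambda,t),\,\lambda\in\Lambda,\,t\in\mathcal{S}\}$, and suppose $\overline{q}(X)>0$. Then the following hold. (i) $M(1,t)=1$ a.s. for every $t\in\mathcal{S}$. (ii) For every $\lambda_1,\lambda_2\in\Lambda$ and $t\in\mathcal{S}$, $M(\lambda_1\lambda_2,t)\overset{d}{=}M^{(1)}M^{(2)}$ with $M^{(1)}\overset{d}{=}M(\lambda_1,\lambda_2t)$ and $M^{(2)}\overset{d}{=}M(\lambda_2,t)$ independent. (iii) Let $\lambda\in\Lambda$ and $t\in\mathcal{S}$. Then for every $n\in\mathbb{N}$ there exist independent identically distributed positive random variables $M^{(1)},\dots,M^{(n)}$ such that $$M(\lambda,t)\overset{d}{=}M^{(1)}\cdots M^{(n)}.$$ Moreover, $M^{(1)}\overset{d}{=}M(\lambda^{1/n},t)$.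
   Context: All processes are real-valued. $\overset{d}{=}$ denotes equality in law, and $\{\cdot\}\overset{d}{=}\{\cdot\}$ equality of finite dimensional distributions. The time set $\mathcal{T}$ is one of $(0,\infty)$, $[0,\infty)$, $(0,T]$, $[0,T]$, $[T,\infty)$ with $T>0$. Every process is assumed not identically null: there is $t\in\mathcal{T}$, $t\neq0$, with $P(X(t)\neq0)>0$. A process $X=\{X(t),\,t\in\mathcal{T}\}$ is multifractal (with sets $\Lambda\subset(0,\infty)$, $\mathcal{S}\subset\mathcal{T}$) if for every $\lambda\in\Lambda$ there exists a family of identically distributed positive random variables $\{M(\lambda,t),\,t\in\mathcal{S}\}$, independent of the process $\{X(t)\}$, such that $\{X(\lambda t)\}_{t\in\mathcal{S}}\overset{d}{=}\{M(\lambda,t)X(t)\}_{t\in\mathcal{S}}$. The random field $M=\{M(\lambda,t),\,\lambda\in\Lambda,\,t\in\mathcal{S}\}$ is called the family of scaling factors. Standing assumption: either $\Lambda=(0,1]$ or $\Lambda=[1,\infty)$, and $\lambda\mathcal{S}=\{\lambda t:t\in\mathcal{S}\}\subset\mathcal{S}$ for every $\lambda\in\Lambda$. $\overline{q}(X)=\sup\{q\ge0:\ \mathbb{E}|X(t)|^q<\infty\text{ for all }t\in\mathcal{T}\}$.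
   Formalization: The process X is additionally assumed not identically null on the set S (P(X(t)≠0)>0 for some t in S), since non-nullity on the time set alone leaves the claim false: if X vanishes on S, the scaling factors are unconstrained. *)

(* Defs.v *)
From HB Require Import structures.
From mathcomp Require Import all_boot all_order all_algebra.
From mathcomp Require Import all_classical all_reals all_analysis.

Set Implicit Arguments.
Unset Strict Implicit.
Unset Printing Implicit Defensive.

Import Order.TTheory GRing.Theory Num.Theory.
Import numFieldNormedType.Exports.

Local Open Scope classical_set_scope.
Local Open Scope ring_scope.

(* Processes are indexed by all of R; every notion below takes the actual index
   set D as an argument and ignores the values outside D. *)

(* Equality in law, possibly between variables on different probability spaces.
   [pushforward P Y] is the library's [distribution P Y]; it is compared on
   measurable sets only, since measures carry unspecified values elsewhere. *)
Definition eq_law (R : realType) (d1 d2 d' : measure_display)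
    (O1 : measurableType d1) (O2 : measurableType d2) (E : measurableType d')
    (P1 : probability O1 R) (Y1 : O1 -> E)
    (P2 : probability O2 R) (Y2 : O2 -> E) : Prop :=
  forall B : set E, measurable B -> pushforward P1 Y1 B = pushforward P2 Y2 B.

Definition eq_fdd (R : realType) (d : measure_display) (O : measurableType d)
    (P : probability O R) (D : set R) (X Y : R -> O -> R) : Prop :=
  forall (n : nat) (t : 'I_n -> R), (forall i, D (t i)) ->
    eq_law P (fun w => [tuple X (t i) w | i < n])
           P (fun w => [tuple Y (t i) w | i < n]).

Definition positive_rv (R : realType) (d : measure_display)
    (O : measurableType d) (P : probability O R) (Y : O -> R) : Prop :=
  \forall w \ae P, 0 < Y w.

Definition sigma_of (R : realType) (d : measure_display) (O : measurableType d)
    (D : set R) (X : R -> O -> R) : set (set O) :=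
  <<s \bigcup_(t in D) preimage_set_system setT (X t) measurable >>.

Definition independent_systems (R : realType) (d : measure_display)
    (O : measurableType d) (P : probability O R) (F G : set (set O)) : Prop :=
  forall A B, F A -> G B -> P (A `&` B) = (P A * P B)%E.

Definition independent_families (R : realType) (d : measure_display)
    (O : measurableType d) (P : probability O R)
    (D : set R) (X : R -> O -> R) (D' : set R) (Y : R -> O -> R) : Prop :=
  independent_systems P (sigma_of D X) (sigma_of D' Y).

Definition independent_pair (R : realType) (d : measure_display)
    (O : measurableType d) (P : probability O R) (Y Z : O -> R) : Prop :=
  independent_systems P (preimage_set_system setT Y measurable)
                        (preimage_set_system setT Z measurable).

(* Subfamilies are covered by taking some of the B i equal to setT. *)
Definition mutually_independent (R : realType) (d : measure_display)
    (O : measurableType d) (P : probability O R) (n : nat)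
    (Y : 'I_n -> O -> R) : Prop :=
  forall B : 'I_n -> set R, (forall i, measurable (B i)) ->
    P (\bigcap_(i in [set: 'I_n]) (Y i @^-1` B i)) =
      (\prod_(i < n) P (Y i @^-1` B i))%E.

Definition iid (R : realType) (d : measure_display) (O : measurableType d)
    (P : probability O R) (n : nat) (Y : 'I_n -> O -> R) : Prop :=
  mutually_independent P Y /\ forall i j, eq_law P (Y i) P (Y j).

Definition time_set (R : realType) (T : set R) : Prop :=
  T = `]0, +oo[%classic \/ T = `[0, +oo[%classic \/
  exists2 T0 : R, 0 < T0 &
    [\/ T = `]0, T0]%classic, T = `[0, T0]%classic | T = `[T0, +oo[%classic].

Definition not_identically_null (R : realType) (d : measure_display)
    (O : measurableType d) (P : probability O R) (T : set R)
    (X : R -> O -> R) : Prop :=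
  exists t, [/\ T t, t != 0 & (0 < P [set w | X t w != 0%R])%E].

Definition multifractal (R : realType) (d : measure_display)
    (O : measurableType d) (P : probability O R) (T Lam S : set R)
    (X : R -> {RV P >-> R}) (M : R -> R -> {RV P >-> R}) : Prop :=
  [/\ Lam `<=` `]0, +oo[%classic, S `<=` T &
    forall l, Lam l ->
      [/\ forall s t, S s -> S t -> eq_law P (M l s) P (M l t),
          forall t, S t -> positive_rv P (M l t),
          independent_families P S (M l) T X &
          eq_fdd P S (fun t => X (l * t)) (fun t w => M l t w * X t w)]].

Arguments multifractal {R d O} P T Lam S X M.

Definition admissible_scales (R : realType) (Lam S : set R) : Prop :=
  (Lam = `]0, 1]%classic \/ Lam = `[1, +oo[%classic) /\
  forall l, Lam l -> [set l * t | t in S] `<=` S.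

Definition qbar (R : realType) (d : measure_display) (O : measurableType d)
    (P : probability O R) (T : set R) (X : R -> O -> R) : \bar R :=
  ereal_sup [set q%:E | q in
    [set q : R | 0 <= q /\
      forall t, T t -> ('E_P[(fun w => (`|X t w| `^ q)%R)] < +oo)%E]].

(* Main.v *)
Require Import Defs.
From HB Require Import structures.
From mathcomp Require Import all_boot all_order all_algebra.
From mathcomp Require Import all_classical all_reals all_analysis.
From mathcomp Require Import measurable_realfun ring lra.

(** The scaling relation is turned into identities between absolute moments.
    Let [q > 0] be such that [E|X(t)|^q] is finite for every [t], and let
    [0 < r < q]. Since [M(l, t)] is independent of [X],
      [E|X(l t)|^r = E M(l, t)^r * E|X(t)|^r],
    and at a time [t0] of [S] where [X] is not null the last factor is finite
    and nonzero, so that it can be cancelled. Hence [m(l) = E M(l, t)^r], which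
    does not depend on [t], is finite, satisfies [m(1) = 1] and is
    multiplicative in [l] ([scaling_moments]). In each of the three
    assertions the two laws to be compared therefore have the same moments of
    every order [r] in [(0, q)]: the first compares [M(1, t)] with the constant
    1, the other two compare a factor with a product of independent copies,
    which live on a product space ([independent_copies_with_laws]).

    What remains is that the law of a positive variable is determined by its
    moments of order in [(0, q)] ([eq_law_of_moments]). With [Y = ln (U / c)]
    this is the uniqueness of a Laplace transform known on an interval,
    and it suffices to recover [P(Y < 0)] for each [c]. Consider the functions
    [f] such that [f Y] has the same integral for both variables: they form a
    vector space closed under dominated pointwise limits, and it contains
    [y |-> e^(r y)] for [0 < r < q]. Difference quotients in [r] put
    [y^k e^(s y)] into it ([same_integral_pow]). The power series of the sine
    is then integrated term by term, because [e^(h |y|)] is still dominated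
    when [h] is small: the bounded functions [f] for which every
    [y^k f(y) e^(s y)] is in the space are stable under multiplication by
    [sin (h y)] ([test_function_sin]), hence by every polynomial in
    [sin (h y)]. Polynomials on a bounded interval approximate a step function
    ([cvg_polynomial_step]), which gives the indicator of [sin (h y) < 0];
    this tends to the indicator of [y < 0] as [h] tends to 0, and finally the
    weight [e^(s y)] is removed by letting [s] tend to 0. *)

Set Implicit Arguments.
Unset Strict Implicit.
Unset Printing Implicit Defensive.

Import Order.TTheory GRing.Theory Num.Theory.
Import numFieldNormedType.Exports.

Local Open Scope classical_set_scope.
Local Open Scope ring_scope.

(** * Real-variable estimates *)

Lemma expR_norm_le (R : realType) (y : R) : expR `|y| <= expR y + expR (- y).
Proof.
by case: (ger0P y) => _; rewrite ?lerDl ?lerDr expR_ge0.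
Qed.

Lemma exprn_le_expR (R : realType) (u : R) k : 0 <= u ->
  u ^+ k <= k`!%:R * expR u.
Proof.
case: k => [u0|k u0].
  by rewrite expr0 fact0 mul1r (le_trans _ (expR_ge1Dx u))// lerDl.
rewrite mulrC -ler_pdivrMr ?ltr0n ?fact_gt0//.
by rewrite (le_trans _ (expR_ge1Dxn k u0))// lerDr.
Qed.

(** The dominating function of the limits that involve powers of [y]: the power
    costs one [e^(e |y|)], the weight is another, and [e^(2 e |y|)] is at most the sum of its two one-sided versions, so that the
    bound only involves exponentials of orders near [r]. *)
Lemma powexp_le (R : realType) (r e y : R) k : 0 < e ->
  `|y| ^+ k * expR (e * `|y|) * expR (r * y) <=
  k`!%:R / e ^+ k * (expR ((r + e *+ 2) * y) + expR ((r - e *+ 2) * y)).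
Proof.
move=> e0.
have ky : `|y| ^+ k <= k`!%:R / e ^+ k * expR (e * `|y|).
  rewrite mulrAC ler_pdivlMr ?exprn_gt0// -exprMn [_ * e]mulrC.
  by rewrite exprn_le_expR// mulr_ge0// ltW.
have e2 : expR (e * `|y|) * expR (e * `|y|) <=
    expR (e *+ 2 * y) + expR (- (e *+ 2 * y)).
  have -> : expR (e * `|y|) * expR (e * `|y|) = expR `|e *+ 2 * y|.
    by rewrite -expRD -mulrDl -mulr2n normrM (gtr0_norm (_ : 0 < e *+ 2))//
      pmulrn_lgt0.
  exact: expR_norm_le.
apply: (@le_trans _ _ (k`!%:R / e ^+ k *
    ((expR (e *+ 2 * y) + expR (- (e *+ 2 * y))) * expR (r * y)))).
  rewrite [X in _ <= X]mulrA ler_wpM2r ?expR_ge0//.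
  apply: (le_trans (ler_wpM2r (expR_ge0 _) ky)).
  by rewrite -[leLHS]mulrA ler_wpM2l// divr_ge0// exprn_ge0// ltW.
by rewrite mulrDl -!expRD -mulNr -!mulrDl [- _ + r]addrC [_ + r]addrC.
Qed.

(** Both inequalities are [1 + x <= e^x], taken at [x] and at [- x]. *)
Lemma expR_sub1_bounds (R : realType) (x : R) : x <= expR x - 1 <= x * expR x.
Proof.
apply/andP; split; first by rewrite lerBrDl expR_ge1Dx.
have := expR_ge1Dx (- x); rewrite -(ler_pM2r (expR_gt0 x)) -expRD addNr expR0.
by rewrite mulrDl mul1r mulNr; lra.
Qed.

Lemma norm_expR_sub1 (R : realType) (x : R) :
  `|expR x - 1| <= `|x| * expR `|x|.
Proof.
have /andP[lo hi] := expR_sub1_bounds x.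
have [x0|x0] := ger0P x.
  by rewrite ger0_norm// (le_trans x0).
have x1 : expR x <= 1 by rewrite expR_le1 ltW.
rewrite ler0_norm ?subr_le0//.
apply: (@le_trans _ _ (- x)); first by rewrite lerN2.
by rewrite ler_peMr ?expR_gt1 ?oppr_ge0 1?ltW// expR_gt1 oppr_gt0.
Qed.

Lemma cvg_expR_quotient (R : realType) (h : nat -> R) (y : R) :
  (forall n, 0 < h n) -> h n @[n --> \oo] --> 0 ->
  (expR (h n * y) - 1) / h n @[n --> \oo] --> y.
Proof.
move=> h0 hc.
have ch : y * expR (h n * y) @[n --> \oo] --> y.
  rewrite -[X in _ --> X]mulr1 -expR0 -[X in expR X](mul0r y).
  apply: cvgM; first exact: cvg_cst.
  apply: continuous_cvg; first exact: continuous_expR.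
  by apply: cvgM => //; exact: cvg_cst.
have hy : h n * y / h n @[n --> \oo] --> y.
  rewrite (_ : (fun n => _) = cst y); first exact: cvg_cst.
  by apply/funext => n; rewrite mulrAC divff ?mul1r// gt_eqF.
apply: (squeeze_cvgr (f := fun=> y)  (h := fun n => y * expR (h n * y))) => //.
- apply: nearW => n; have /andP[lo hi] := expR_sub1_bounds (h n * y).
  apply/andP; split; first by rewrite ler_pdivlMr// mulrC.
  by rewrite ler_pdivrMr// [y * _ * _]mulrC mulrA.
- exact: cvg_cst.
Qed.

Lemma norm_series_sin_coeff (R : realType) (x : R) n :
  `|series (sin_coeff x) n| <= expR `|x|.
Proof.
apply: (@le_trans _ _ (series (exp_coeff `|x|) n)).
  rewrite /series/= (le_trans (ler_norm_sum _ _ _))//; apply: ler_sum => i _.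
  rewrite /exp_coeff /sin_coeff/= !normrM normfV !normr_nat !normrX normrN normr1.
  rewrite expr1n mulr1.
  by case: odd; rewrite ?mul1r// !mul0r divr_ge0// exprn_ge0.
apply: nondecreasing_cvgn_le; last exact: is_cvg_series_exp_coeff.
apply/nondecreasing_seqP => k; rewrite /series/= big_nat_recr//= lerDl.
by rewrite divr_ge0// exprn_ge0.
Qed.

Lemma cvg_series_sin_coeff (R : realType) (x : R) :
  series (sin_coeff x) @ \oo --> sin x.
Proof. by rewrite unlock; exact: is_cvg_series_sin_coeff. Qed.

Lemma bernoulli_le (R : realType) (a : R) n : -1 <= a ->
  1 + n%:R * a <= (1 + a) ^+ n.
Proof.
move=> a1; elim: n => [|n IH]; first by rewrite mul0r addr0 expr0.
have a0 : 0 <= 1 + a by lra.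
rewrite exprS (le_trans _ (ler_wpM2l a0 IH))//.
rewrite -natr1; have : 0 <= n%:R * a ^+ 2 by rewrite mulr_ge0// sqr_ge0.
by rewrite expr2; nra.
Qed.

(** By Bernoulli, since [(1 - a)^m (1 + a)^m = (1 - a^2)^m <= 1]. *)
Lemma exprn_1B_le (R : realType) (a : R) m : 0 <= a <= 1 ->
  (1 - a) ^+ m <= (1 + m%:R * a)^-1.
Proof.
move=> /andP[a0 a1].
have b : 1 + m%:R * a <= (1 + a) ^+ m by apply: bernoulli_le; lra.
have m0 : 0 <= m%:R * a by rewrite mulr_ge0.
have p : 0 < 1 + m%:R * a by lra.
rewrite -[leRHS]mul1r ler_pdivlMr//.
apply: (le_trans (ler_wpM2l (exprn_ge0 _ _) b)); first by lra.
by rewrite -exprMn -subr_sqr expr1n exprn_ile1//; nra.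
Qed.

(** With [w = sqrt z], [n w^n] stays bounded (it is at most [1 / (1 - w)]) while
    the other factor [w^n] tends to 0. *)
Lemma cvg_natM_expr (R : realType) (z : R) : 0 <= z < 1 ->
  n%:R * z ^+ n @[n --> \oo] --> (0 : R).
Proof.
move=> /andP[z0 z1]; set w := Num.sqrt z.
have w0 : 0 <= w by rewrite sqrtr_ge0.
have w1 : w < 1 by rewrite /w -[ltRHS]sqrtr1 ltr_sqrt.
have wz : w * w = z by rewrite -expr2 sqr_sqrtr.
have bd n : n%:R * z ^+ n <= (1 - w)^-1 * w ^+ n.
  rewrite -wz exprMn mulrA ler_wpM2r ?exprn_ge0//.
  rewrite -[leRHS]mul1r ler_pdivlMr ?subr_gt0//.
  have /= := @exprn_1B_le R (1 - w) n _; rewrite subKr => /(_ _).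
  have c : 0 <= 1 - w <= 1 by lra.
  move=> /(_ c) H.
  have p : 0 <= n%:R * (1 - w) by rewrite mulr_ge0// subr_ge0 ltW.
  rewrite mulrAC (le_trans (ler_wpM2l p H))//.
  by rewrite ler_pdivrMr ?mul1r; lra.
apply: (squeeze_cvgr (f := fun=> 0) (h := fun n => (1 - w)^-1 * w ^+ n)).
- by apply: nearW => n; rewrite bd mulr_ge0// exprn_ge0.
- exact: cvg_cst.
- rewrite -[X in _ --> X](mulr0 (1 - w)^-1).
  by apply: cvgM; [exact: cvg_cst|apply: cvg_expr; rewrite ger0_norm].
Qed.

(** Polynomials in [x] with values in [[0, 1]] that converge to a step function.
    Below [1/2] Bernoulli gives the lower bound [1 - n (2x)^n]; from [1/2] on,
    [exprn_1B_le] gives the upper bound [1 / (1 + n (2x)^n)]. The factor [n] in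
    the exponent makes the limit 0 at [x = 1/2] too, where the exponent [2^n]
    alone would give [1/e]. *)
Lemma cvg_polynomial_step (R : realType) (x : R) : 0 <= x <= 1 ->
  (1 - x ^+ n) ^+ (n * 2 ^ n) @[n --> \oo] --> ((x < 2^-1)%R%:R : R).
Proof.
move=> /andP[x0 x1].
have xn n : 0 <= x ^+ n <= 1 by rewrite exprn_ge0//= exprn_ile1.
have e (n : nat) : (n * 2 ^ n)%N%:R * x ^+ n = n%:R * (2 * x) ^+ n :> R.
  by rewrite natrM natrX exprMn mulrA.
case: ltP => xh.
- apply: (squeeze_cvgr (f := fun n => 1 - n%:R * (2 * x) ^+ n) (h := cst 1)).
  + apply: nearW => n; rewrite -e -mulrN bernoulli_le; last first.
      by have := xn n; lra.
    by rewrite exprn_ile1//; have := xn n; lra.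
  + rewrite -[X in _ --> X]subr0; apply: cvgB; first exact: cvg_cst.
    by apply: cvg_natM_expr; lra.
  + exact: cvg_cst.
- apply: (squeeze_cvgr (f := cst 0) (h := fun n => n.+1%:R^-1)).
  + apply: nearW => n; have/andP[u v] := xn n; rewrite exprn_ge0 ?subr_ge0//=.
    rewrite (le_trans (exprn_1B_le _ (xn n)))// e lef_pV2 ?posrE//; last first.
      by rewrite ltr_wpDr// mulr_ge0// exprn_ge0// mulr_ge0.
    rewrite -natr1 addrC lerD2l ler_peMr// exprn_ege1//; lra.
  + exact: cvg_cst.
  + exact: cvg_harmonic.
Qed.

(** * Functions with equal integrals along two random variables *)

Section SameIntegral.
Context (R : realType) (d1 d2 : measure_display).
Context (O1 : measurableType d1) (O2 : measurableType d2).
Context (P1 : probability O1 R) (P2 : probability O2 R).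
Context (Y1 : {RV P1 >-> R}) (Y2 : {RV P2 >-> R}).
Implicit Types f g : R -> R.

(** Integrability is part of the condition so that these functions form a vector
    space. *)
Definition same_integral f :=
  [/\ measurable_fun setT f,
      P1.-integrable setT (EFin \o (f \o Y1)),
      P2.-integrable setT (EFin \o (f \o Y2)) &
      (\int[P1]_w (f (Y1 w))%:E = \int[P2]_w (f (Y2 w))%:E)%E].

Lemma same_integral_lin a b f g : same_integral f -> same_integral g ->
  same_integral (fun y => a * f y + b * g y).
Proof.
move=> [mf f1 f2 fE] [mg g1 g2 gE].
have Zl d (O : measurableType d) (Q : probability O R) (h : O -> R) c :
    Q.-integrable setT (EFin \o h) ->
    Q.-integrable setT (EFin \o (fun w => c * h w)).
  by move=> /(integrableZl measurableT c).
split.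
- by apply: measurable_funD; apply: measurable_funM.
- by apply: (integrableD measurableT (Zl _ _ _ _ a f1) (Zl _ _ _ _ b g1)).
- by apply: (integrableD measurableT (Zl _ _ _ _ a f2) (Zl _ _ _ _ b g2)).
have E d (O : measurableType d) (Q : probability O R) (Y : O -> R) :
    Q.-integrable setT (EFin \o (f \o Y)) ->
    Q.-integrable setT (EFin \o (g \o Y)) ->
    (\int[Q]_w (a * f (Y w) + b * g (Y w))%:E =
     a%:E * \int[Q]_w (f (Y w))%:E + b%:E * \int[Q]_w (g (Y w))%:E)%E.
  move=> fY gY.
  under eq_integral do rewrite EFinD.
  rewrite (integralD_EFin measurableT (Zl _ _ _ _ a fY) (Zl _ _ _ _ b gY)).
  congr (_ + _)%E.
    by rewrite -(integralZl measurableT fY).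
  by rewrite -(integralZl measurableT gY).
by rewrite E// E// fE gE.
Qed.

Lemma same_integral_ext f g : f =1 g -> same_integral f -> same_integral g.
Proof. by move=> /funext ->. Qed.

Lemma same_integral_dominated (f_ : nat -> R -> R) f g :
  (forall n, same_integral (f_ n)) -> same_integral g ->
  (forall n y, `|f_ n y| <= g y) -> (forall y, f_ n y @[n --> \oo] --> f y) ->
  same_integral f.
Proof.
move=> sf_ [mg g1 g2 _] f_g f_f.
have mf_ n : measurable_fun setT (f_ n) by have [] := sf_ n.
have mf : measurable_fun setT f.
  by apply: (measurable_fun_cvg mf_) => y _; exact: f_f.
have D d (O : measurableType d) (Q : probability O R) (Y : {RV Q >-> R}) :
    Q.-integrable setT (EFin \o (g \o Y)) ->
    Q.-integrable setT (EFin \o (f \o Y)) /\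
    ((\int[Q]_w (f_ n (Y w))%:E)%E @[n --> \oo] -->
     (\int[Q]_w (f (Y w))%:E)%E).
  move=> gY.
  have [] := @dominated_convergence _ _ _ Q setT measurableT
    (fun n w => (f_ n (Y w))%:E) (fun w => (f (Y w))%:E)
    (fun w => (g (Y w))%:E) _ _ _ gY _.
  - by move=> n; apply/measurable_EFinP; exact: measurableT_comp.
  - by apply/measurable_EFinP; exact: measurableT_comp.
  - by apply: aeW => w _; apply/fine_cvgP; split; [exact: nearW|exact: f_f].
  - by apply: aeW => w n _ /=; rewrite lee_fin; exact: f_g.
  by move=> ? _ ?; split.
have [f1 c1] := D _ _ _ _ g1; have [f2 c2] := D _ _ _ _ g2.
split=> //; apply: cvg_unique c1 _ => //.
suff -> : (fun n => \int[P1]_w (f_ n (Y1 w))%:E)%E =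
          (fun n => \int[P2]_w (f_ n (Y2 w))%:E)%E by [].
by apply/funext => n; have [] := sf_ n.
Qed.


(** Induction on [k]: [y^(k+1) e^(r y)] is the derivative in [r] of
    [y^k e^(r y)], hence a dominated limit of difference quotients. *)
Lemma same_integral_pow s :
    (forall r, 0 < r < s *+ 2 -> same_integral (fun y => expR (r * y))) ->
  forall k r, 0 < r < s *+ 2 -> same_integral (fun y => y ^+ k * expR (r * y)).
Proof.
move=> Hs; elim=> [|k IH] r /andP[r0 rs].
  apply: same_integral_ext (Hs r _); last by rewrite r0.
  by move=> y; rewrite expr0 mul1r.
(* a third of the distance from [r] to the ends of the interval: the
   dominating exponentials have orders [r - 2e] and [r + 2e] *)
pose e : R := Num.min r (s *+ 2 - r) / 3.
have e0 : 0 < e by rewrite divr_gt0// lt_min r0 subr_gt0.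
have er : e *+ 3 <= r by rewrite -mulr_natr divfK// ge_min lexx.
have es : e *+ 3 <= s *+ 2 - r by rewrite -mulr_natr divfK// ge_min lexx orbT.
pose h n : R := e / n.+1%:R.
have h0 n : 0 < h n by rewrite divr_gt0.
have he n : h n <= e by rewrite ler_pdivrMr// ler_peMr ?ler1n// ltW.
pose C : R := k.+1`!%:R / e ^+ k.+1.
pose f_ n y := y ^+ k * expR (r * y) * ((expR (h n * y) - 1) / h n).
apply: (@same_integral_dominated f_ _ (fun y =>
  C * expR ((r + e *+ 2) * y) + C * expR ((r - e *+ 2) * y))).
- move=> n; apply: (@same_integral_ext (fun y =>
    (h n)^-1 * (y ^+ k * expR ((r + h n) * y)) +
    (- (h n)^-1) * (y ^+ k * expR (r * y)))).
    by move=> y; rewrite /f_ mulrDl expRD; ring.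
  apply: same_integral_lin; apply: IH; last by rewrite r0.
  have := h0 n; have := he n; lra.
- by apply: same_integral_lin; apply: Hs; lra.
- move=> n y; rewrite -mulrDr (le_trans _ (powexp_le r y k.+1 e0))//.
  have quot : `|(expR (h n * y) - 1) / h n| <= `|y| * expR (e * `|y|).
    rewrite normrM normfV (gtr0_norm (h0 n)) ler_pdivrMr//.
    rewrite (le_trans (norm_expR_sub1 _))// normrM (gtr0_norm (h0 n)).
    rewrite -[leLHS]mulrA [leLHS]mulrC ler_wpM2r ?(ltW (h0 n))// ler_wpM2l//.
    by rewrite ler_expR ler_wpM2r.
  rewrite /f_ normrM [X in X * _]normrM normrX (ger0_norm (expR_ge0 _)).
  apply: (le_trans (ler_wpM2l _ quot)).
    by rewrite mulr_ge0 ?exprn_ge0 ?expR_ge0.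
  by rewrite exprSr le_eqVlt; apply/orP; left; apply/eqP; ring.
- move=> y; rewrite exprSr.
  rewrite (_ : y ^+ k * y * _ = y ^+ k * expR (r * y) * y); last by rewrite mulrAC.
  apply: cvgM; first exact: cvg_cst.
  apply: cvg_expR_quotient => //.
  rewrite -[X in _ --> X](mulr0 e); apply: cvgM; first exact: cvg_cst.
  exact: cvg_harmonic.
Qed.

(** The powers of [y] make the class stable under multiplication by the terms
    of a power series, boundedness provides the domination. *)
Definition test_function s f :=
  (exists C, forall y, `|f y| <= C) /\
  forall k, same_integral (fun y => y ^+ k * f y * expR (s * y)).

Lemma test_function_lin s a b f g : test_function s f -> test_function s g ->
  test_function s (fun y => a * f y + b * g y).
Proof.
move=> [[C fC] fs] [[D gD] gs]; split.
  exists (`|a| * C + `|b| * D) => y.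
  by rewrite (le_trans (ler_normD _ _))// !normrM lerD// ler_wpM2l.
move=> k; apply: same_integral_ext (same_integral_lin a b (fs k) (gs k)).
by move=> y /=; ring.
Qed.

Lemma test_function_ext s f g : f =1 g -> test_function s f -> test_function s g.
Proof. by move=> /funext ->. Qed.

(** The partial sums of the power series of [sin (h y)] are at most
    [e^(h |y|)], which [powexp_le] absorbs as long as [h <= s / 4]: the
    dominating exponentials have orders [s / 2] and [3 s / 2]. *)
Lemma test_function_sin s h f : 0 < s ->
    (forall r, 0 < r < s *+ 2 -> same_integral (fun y => expR (r * y))) ->
    0 <= h <= s / 4 -> test_function s f ->
  test_function s (fun y => f y * sin (h * y)).
Proof.
move=> s0 Hs /andP[h0 hs] [[C fC] fs]; split.
  exists C => y; rewrite normrM -[C]mulr1 ler_pM//.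
  by rewrite ler_norml sin_geN1 sin_le1.
move=> k.
have C0 : 0 <= C by rewrite (le_trans _ (fC 0)).
pose e : R := s / 4; have e0 : 0 < e by rewrite divr_gt0.
pose D : R := C * (k`!%:R / e ^+ k).
apply: (@same_integral_dominated
  (fun n y => y ^+ k * (f y * series (sin_coeff (h * y)) n) * expR (s * y)) _
  (fun y => D * expR ((s + e *+ 2) * y) + D * expR ((s - e *+ 2) * y))).
- elim=> [|n IH].
    (* the empty partial sum: the zero function, as a trivial combination *)
    apply: same_integral_ext (same_integral_lin 0 0 (fs 0%N) (fs 0%N)) => y.
    by rewrite /series/= big_nil; ring.
  apply: same_integral_ext (same_integral_lin 1
    (sin_coeff 1 n * h ^+ n) IH (fs (k + n)%N)) => y.
  rewrite /series/= [in RHS]big_nat_recr//= /sin_coeff/= expr1n exprMn exprD.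
  by ring.
- by apply: same_integral_lin; apply: Hs; rewrite /e; lra.
- move=> n y; rewrite /D -mulrDr -[leRHS]mulrA.
  rewrite (le_trans _ (ler_wpM2l C0 (powexp_le s y k e0)))//.
  rewrite !normrM normrX (ger0_norm (expR_ge0 _)).
  rewrite [leRHS](_ : _ = `|y| ^+ k * (C * expR (e * `|y|)) * expR (s * y));
    last by ring.
  rewrite ler_wpM2r ?expR_ge0// ler_wpM2l ?exprn_ge0// ler_pM//.
  rewrite (le_trans (norm_series_sin_coeff _ _))// ler_expR normrM.
  by rewrite (ger0_norm h0) ler_wpM2r.
- move=> y; apply: cvgM; last exact: cvg_cst.
  apply: cvgM; first exact: cvg_cst.
  apply: cvgM; first exact: cvg_cst.
  exact: cvg_series_sin_coeff.
Qed.

(** With [x = (1 + sin (h y)) / 2], which has values in [[0, 1]], the condition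
    [sin (h y) < 0] is [x < 1/2], and polynomials in [x] are test functions. *)
Lemma same_integral_sin_lt0 s h : 0 < s ->
    (forall r, 0 < r < s *+ 2 -> same_integral (fun y => expR (r * y))) ->
    0 <= h <= s / 4 ->
  same_integral (fun y => (sin (h * y) < 0)%R%:R * expR (s * y)).
Proof.
move=> s0 Hs hs; pose x y : R := 2^-1 + 2^-1 * sin (h * y).
have x01 y : 0 <= x y <= 1.
  by have := sin_geN1 (h * y); have := sin_le1 (h * y); rewrite /x; lra.
have T1 : test_function s (cst 1).
  split; first by exists 1 => y; rewrite normr1.
  move=> k; apply: same_integral_ext (same_integral_pow Hs k (r := s) _).
    by move=> y; rewrite mulr1.
  by rewrite s0 mulr2n ltrDr.
have Tx f : test_function s f -> test_function s (fun y => f y * x y).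
  move=> Tf; apply: test_function_ext (test_function_lin 2^-1 2^-1 Tf
    (test_function_sin s0 Hs hs Tf)) => y.
  by rewrite /x; ring.
have Txn n f : test_function s f -> test_function s (fun y => f y * x y ^+ n).
  move=> Tf; elim: n => [|n]; first by apply: test_function_ext Tf => y; rewrite mulr1.
  by move/Tx; apply: test_function_ext => y; rewrite exprSr mulrA.
have Tp n m : test_function s (fun y => (1 - x y ^+ n) ^+ m).
  elim: m => [|m IH]; first exact: T1.
  apply: test_function_ext (test_function_lin 1 (-1) IH (Txn n _ IH)) => y.
  by rewrite exprS; ring.
apply: (@same_integral_dominated (fun n y =>
    (1 - x y ^+ n) ^+ (n * 2 ^ n) * expR (s * y)) _
  (fun y => expR (s * y))).
- move=> n; have [_ /(_ 0%N)] := Tp n (n * 2 ^ n)%N; apply: same_integral_ext => y.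
  by rewrite expr0 mul1r.
- by apply: Hs; rewrite s0 mulr2n ltrDr.
- move=> n y; rewrite normrM (ger0_norm (expR_ge0 _)) ler_piMl ?expR_ge0//.
  have /andP[a b] := x01 y.
  have /andP[u v] : 0 <= x y ^+ n <= 1 by rewrite exprn_ge0//= exprn_ile1.
  by rewrite ger0_norm ?exprn_ge0 ?exprn_ile1//; lra.
- move=> y; apply: cvgM; last exact: cvg_cst.
  have -> : (sin (h * y) < 0) = (x y < 2^-1).
    by rewrite /x; apply/idP/idP; lra.
  exact: cvg_polynomial_step.
Qed.

(** For fixed [y] and small [h > 0], [sin (h y)] has the sign of [y]. *)
Lemma same_integral_expR_lt0 s : 0 < s ->
    (forall r, 0 < r < s *+ 2 -> same_integral (fun y => expR (r * y))) ->
  same_integral (fun y => (y < 0)%R%:R * expR (s * y)).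
Proof.
move=> s0 Hs; pose h n : R := s / 4 / n.+1%:R.
apply: (@same_integral_dominated (fun n y => (sin (h n * y) < 0)%R%:R * expR (s * y)) _
  (fun y => expR (s * y))).
- move=> n; apply: same_integral_sin_lt0 => //.
  rewrite divr_ge0 ?divr_ge0 ?(ltW s0)//=.
  by rewrite ler_pdivrMr// ler_peMr ?ler1n// divr_ge0 ?ltW.
- by apply: Hs; rewrite s0 mulr2n ltrDr.
- move=> n y; rewrite normrM (ger0_norm (expR_ge0 _)) ler_piMl ?expR_ge0//.
  by case: ltP; rewrite ?normr0 ?normr1.
- move=> y; apply: cvgM; last exact: cvg_cst.
  have hy : h n * y @[n --> \oo] --> 0.
    rewrite -[X in _ --> X](mul0r y); apply: cvgM; last exact: cvg_cst.
    rewrite -[X in _ --> X](mulr0 (s / 4)); apply: cvgM; first exact: cvg_cst.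
    exact: cvg_harmonic.
  apply: cvg_near_cst.
  (* the sine has the sign of its argument on [(-2, 2)] *)
  have /cvgrPdist_lt /(_ 2 (ltr0Sn R 1)) := hy.
  apply: filterS => n; rewrite sub0r normrN ltr_norml => /andP[l u].
  have h0 : 0 < h n by rewrite !divr_gt0.
  congr (nat_of_bool _)%:R.
  have [y0|y0|->] := ltgtP y 0.
  + by rewrite -oppr_gt0 -sinN sin2_gt0// -mulrN mulr_gt0 ?oppr_gt0//= mulrN; lra.
  + by apply/negbTE; rewrite -leNgt ltW// sin2_gt0// mulr_gt0//=.
  + by rewrite mulr0 sin0 ltxx.
Qed.

(** On [y < 0] the weight [e^(s y)] is at most 1, so it may be removed by
    letting [s] tend to 0. *)
Lemma same_integral_lt0 q : 0 < q ->
    (forall r, 0 < r < q -> same_integral (fun y => expR (r * y))) ->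
  same_integral (fun y => (y < 0)%R%:R).
Proof.
move=> q0 Hq; pose s n : R := q / 2 / n.+1%:R.
have s0 n : 0 < s n by rewrite !divr_gt0.
have sq n : s n <= q / 2 by rewrite ler_pdivrMr// ler_peMr ?ler1n// divr_ge0 ?ltW.
apply: (@same_integral_dominated (fun n y => (y < 0)%R%:R * expR (s n * y)) _
   (cst 1)).
- move=> n; apply: same_integral_expR_lt0 => // r /andP[r0 rs]; apply: Hq.
  by have := sq n; lra.
- split=> //=; last by rewrite !integral_cst//= !probability_setT.
    by apply: finite_measure_integrable_cst.
  by apply: finite_measure_integrable_cst.
- move=> n y; rewrite normrM (ger0_norm (expR_ge0 _)).
  case: ltP => y0; last by rewrite normr0 mul0r.
  by rewrite normr1 mul1r expR_le1 pmulr_rle0 ?ltW.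
- move=> y; rewrite -[X in _ --> X]mulr1; apply: cvgM; first exact: cvg_cst.
  rewrite -expR0; apply: continuous_cvg; first exact: continuous_expR.
  rewrite -[X in _ --> X](mul0r y); apply: cvgM; last exact: cvg_cst.
  rewrite -[X in _ --> X](mulr0 (q / 2)); apply: cvgM; first exact: cvg_cst.
  exact: cvg_harmonic.
Qed.

End SameIntegral.

(** * Moments determine the law of a positive variable *)

Definition abs_moment (R : realType) (d : measure_display)
    (O : measurableType d) (P : probability O R) (U : O -> R) (r : R) : \bar R :=
  (\int[P]_w (`|U w| `^ r)%:E)%E.

Lemma measurable_abs_powR (R : realType) (d : measure_display)
    (O : measurableType d) (U : O -> R) r :
  measurable_fun setT U -> measurable_fun setT (fun w => `|U w| `^ r).
Proof.
move=> mU; apply: (measurableT_comp (measurable_powR r)).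
exact: measurableT_comp.
Qed.

Lemma eq_law_ltP (R : realType) (d1 d2 : measure_display)
    (O1 : measurableType d1) (O2 : measurableType d2)
    (P1 : probability O1 R) (P2 : probability O2 R) (U : O1 -> R) (V : O2 -> R) :
    measurable_fun setT U -> measurable_fun setT V ->
    (forall c, P1 [set w | U w < c] = P2 [set w | V w < c]) ->
  eq_law P1 U P2 V.
Proof.
move=> mU mV UV B mB.
pose fU := isMeasurableFun.Build _ _ _ _ _ mU.
pose fV := isMeasurableFun.Build _ _ _ _ _ mV.
pose RU : {RV P1 >-> R} := HB.pack U fU.
pose RV : {RV P2 >-> R} := HB.pack V fV.
apply: (measure_unique (@RGenInftyO.G R) (fun k => `]-oo, k%:R[%classic) _ _ _ _
  (distribution P1 RU) (distribution P2 RV)) => //.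
- exact: RGenInftyO.measurableE.
- move=> _ _ [x ->] [y ->]; exists (Num.min x y).
  by apply/seteqP; split=> z /=; rewrite !in_itv/= lt_min => /andP.
- by move=> k; exists k%:R.
- rewrite -subTset => x _; exists (Num.trunc `|x|).+1 => //=.
  by rewrite in_itv/= (le_lt_trans (ler_norm x))// truncnS_gt.
- move=> _ [x ->].
  have S T (W : T -> R) : W @^-1` `]-oo, x[%classic = [set w | W w < x].
    by apply/seteqP; split=> w /=; rewrite in_itv.
  change (P1 (U @^-1` `]-oo, x[%classic) = P2 (V @^-1` `]-oo, x[%classic)).
  by rewrite !S.
- by move=> k; rewrite (le_lt_trans (probability_le1 _ _)) ?ltry.
Qed.

(** [P(U < c) = P(ln (U / c) < 0)], and the exponential moments of [ln (U / c)]
    are those of [ln U] up to the factor [c^(-r)]. *)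
Lemma eq_law_of_moments (R : realType) (d1 d2 : measure_display)
    (O1 : measurableType d1) (O2 : measurableType d2)
    (P1 : probability O1 R) (P2 : probability O2 R)
    (U : O1 -> R) (V : O2 -> R) (q : R) :
    measurable_fun setT U -> measurable_fun setT V ->
    positive_rv P1 U -> positive_rv P2 V -> 0 < q ->
    (forall r, 0 < r < q ->
      abs_moment P1 U r = abs_moment P2 V r /\ (abs_moment P1 U r < +oo)%E) ->
  eq_law P1 U P2 V.
Proof.
move=> mU mV U0 V0 q0 UV; apply: eq_law_ltP => // c.
have [c0|c0] := leP c 0.
  have N d (O : measurableType d) (P : probability O R) (W : O -> R) :
      measurable_fun setT W -> positive_rv P W -> P [set w | W w < c] = 0%E.
    move=> mW W0; apply/negligibleP.
      by rewrite -[X in measurable X]setTI; exact: measurable_fun_ltr.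
    apply: negligibleS W0 => w /= wc; apply/negP; rewrite -leNgt ltW//.
    exact: lt_le_trans c0.
  by rewrite !N.
have mln d (O : measurableType d) (W : O -> R) : measurable_fun setT W ->
    measurable_fun setT (fun w => ln (W w / c)).
  move=> mW; apply: (measurableT_comp (@measurable_ln R)).
  exact: measurable_funM.
have E d (O : measurableType d) (P : probability O R) (W : O -> R) r :
    measurable_fun setT W -> positive_rv P W ->
    (\int[P]_w (expR (r * ln (W w / c)))%:E =
     (c `^ r)^-1%:E * abs_moment P W r)%E.
  move=> mW W0; rewrite -ge0_integralZl//; last 2 first.
  - by apply/measurable_EFinP; exact: measurable_abs_powR.
  - by rewrite lee_fin invr_ge0 powR_ge0.
  apply: ge0_ae_eq_integral => //.
  - apply/measurable_EFinP; apply: measurableT_comp => //.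
    by apply: measurable_funM => //; exact: (mln).
  - apply: measurable_funeM; apply/measurable_EFinP.
    exact: measurable_abs_powR.
  - by move=> w _; rewrite -EFinM lee_fin mulr_ge0 ?invr_ge0 ?powR_ge0.
  apply: filterS W0 => w W0 _ /=; rewrite -EFinM; congr EFin.
  rewrite ln_div ?posrE// mulrBr expRB [RHS]mulrC; congr (_ / _).
  + by rewrite gtr0_norm// /powR gt_eqF.
  + by rewrite /powR gt_eqF.
pose fU := isMeasurableFun.Build _ _ _ _ _ (mln _ _ _ mU).
pose fV := isMeasurableFun.Build _ _ _ _ _ (mln _ _ _ mV).
pose Y1 : {RV P1 >-> R} := HB.pack (fun w => ln (U w / c)) fU.
pose Y2 : {RV P2 >-> R} := HB.pack (fun w => ln (V w / c)) fV.
have I d (O : measurableType d) (P : probability O R) (W : O -> R) r :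
    measurable_fun setT W -> positive_rv P W -> (abs_moment P W r < +oo)%E ->
    P.-integrable setT (EFin \o (expR \o (fun w => r * ln (W w / c)))).
  move=> mW W0 fin; apply/integrableP; split.
    apply/measurable_EFinP; apply: measurableT_comp => //.
    by apply: measurable_funM => //; exact: (mln).
  under eq_integral do rewrite /= ger0_norm ?expR_ge0//.
  rewrite E// lte_mul_pinfty ?lee_fin ?invr_ge0 ?powR_ge0//.
have [_ _ _ /=] : same_integral Y1 Y2 (fun y => (y < 0)%R%:R).
  apply: (same_integral_lt0 q0) => r r0q; have [Er fr] := UV r r0q; split.
  - by apply: measurableT_comp => //; exact: measurable_funM.
  - exact: I.
  - by apply: I => //; rewrite -Er.
  - by rewrite /= !E// Er.
have L d (O : measurableType d) (P : probability O R) (W : O -> R) :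
    measurable_fun setT W -> positive_rv P W ->
    (\int[P]_w ((ln (W w / c) < 0)%R%:R)%:E = P [set w | (W w < c)%R])%E.
  move=> mW W0.
  have mlt : measurable [set w | (W w < c)%R].
    by rewrite -[X in measurable X]setTI; exact: measurable_fun_ltr.
  rewrite -[X in P X]setIT -integral_indic//.
  apply: ge0_ae_eq_integral => //.
  - apply/measurable_EFinP.
    apply: (measurableT_comp (f := fun b : bool => b%:R : R)) => //.
    by apply: measurable_fun_ltr => //; exact: (mln).
  - by apply/measurable_EFinP; exact: measurable_indic.
  apply: filterS W0 => w W0 _ /=; congr EFin.
  rewrite indicE; congr (nat_of_bool _)%:R.
  rewrite ltNge ln_div ?posrE// subr_ge0 ler_ln ?posrE// -ltNge.
  by apply/idP/idP; rewrite inE.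
by rewrite !L.
Qed.

(** * Integrals, laws and independence *)

Lemma eq_law_integral (R : realType) (d1 d2 : measure_display)
    (O1 : measurableType d1) (O2 : measurableType d2)
    (P1 : probability O1 R) (P2 : probability O2 R)
    (U : O1 -> R) (V : O2 -> R) (g : R -> R) :
    measurable_fun setT U -> measurable_fun setT V -> measurable_fun setT g ->
    (forall y, 0 <= g y) -> eq_law P1 U P2 V ->
  (\int[P1]_w (g (U w))%:E = \int[P2]_w (g (V w))%:E)%E.
Proof.
move=> mU mV mg g0 UV.
pose fU := isMeasurableFun.Build _ _ _ _ _ mU.
pose fV := isMeasurableFun.Build _ _ _ _ _ mV.
pose RU : {RV P1 >-> R} := HB.pack U fU.
pose RV : {RV P2 >-> R} := HB.pack V fV.
have mg' : measurable_fun setT (EFin \o g) by exact/measurable_EFinP.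
have g0' y : (0 <= (EFin \o g) y)%E by rewrite lee_fin.
rewrite -(ge0_integral_distribution RU mg' g0').
rewrite -(ge0_integral_distribution RV mg' g0').
by apply: eq_measure_integral => A mA _; exact: UV.
Qed.

Lemma integral_prod_tensor (R : realType) (d1 d2 : measure_display)
    (O1 : measurableType d1) (O2 : measurableType d2)
    (P1 : probability O1 R) (P2 : probability O2 R) (f : O1 -> R) (g : O2 -> R) :
    measurable_fun setT f -> measurable_fun setT g ->
    (forall x, 0 <= f x) -> (forall y, 0 <= g y) ->
  (\int[P1 \x P2]_z (f z.1 * g z.2)%:E =
   \int[P1]_x (f x)%:E * \int[P2]_y (g y)%:E)%E.
Proof.
move=> mf mg f0 g0.
rewrite fubini_tonelli1; last 2 first.
- by apply/measurable_EFinP; apply: measurable_funM; apply: measurableT_comp.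
- by move=> z; rewrite lee_fin mulr_ge0.
rewrite /fubini_F/= -ge0_integralZr//; last 3 first.
- exact/measurable_EFinP.
- by move=> x _; rewrite lee_fin.
- by apply: integral_ge0 => y _; rewrite lee_fin.
apply: eq_integral => x _; rewrite -ge0_integralZl//.
- exact/measurable_EFinP.
- by move=> y _; rewrite lee_fin.
- by rewrite lee_fin.
Qed.

(** The joint law of [(U, V)] agrees with the product of the marginal laws on
    rectangles, hence everywhere. *)
Lemma integral_independent (R : realType) (d : measure_display)
    (O : measurableType d) (P : probability O R) (U V : O -> R) (f g : R -> R) :
    measurable_fun setT U -> measurable_fun setT V ->
    measurable_fun setT f -> measurable_fun setT g ->
    (forall x, 0 <= f x) -> (forall y, 0 <= g y) ->
    (forall A B, measurable A -> measurable B ->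
      P (U @^-1` A `&` V @^-1` B) = (P (U @^-1` A) * P (V @^-1` B))%E) ->
  (\int[P]_w (f (U w) * g (V w))%:E =
   \int[P]_w (f (U w))%:E * \int[P]_w (g (V w))%:E)%E.
Proof.
move=> mU mV mf mg f0 g0 ind.
have mUV : measurable_fun setT (fun w => (U w, V w)) by exact: measurable_fun_pair.
pose fU := isMeasurableFun.Build _ _ _ _ _ mU.
pose fV := isMeasurableFun.Build _ _ _ _ _ mV.
pose fUV := isMeasurableFun.Build _ _ _ _ _ mUV.
pose RU : {RV P >-> R} := HB.pack U fU.
pose RV : {RV P >-> R} := HB.pack V fV.
pose RUV : {RV P >-> (R * R)%type} := HB.pack (fun w => (U w, V w)) fUV.
have mf' : measurable_fun setT (EFin \o f) by exact/measurable_EFinP.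
have f0' y : (0 <= (EFin \o f) y)%E by rewrite lee_fin.
have mg' : measurable_fun setT (EFin \o g) by exact/measurable_EFinP.
have g0' y : (0 <= (EFin \o g) y)%E by rewrite lee_fin.
rewrite -(ge0_integral_distribution RU mf' f0').
rewrite -(ge0_integral_distribution RV mg' g0').
rewrite -integral_prod_tensor//.
transitivity (\int[distribution P RUV]_z (f z.1 * g z.2)%:E)%E.
  rewrite (@ge0_integral_distribution _ _ _ _ _ P RUV
    (fun z => (f z.1 * g z.2)%:E))//.
    apply/measurable_EFinP; apply: measurable_funM; exact: measurableT_comp.
  by move=> z; rewrite lee_fin mulr_ge0.
apply: eq_measure_integral => A mA _; apply/esym.
by apply: product_measure_unique => // B C mB mC; exact: ind.
Qed.

(** Induction on [n], with one more factor [P] at each step. The conclusion is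
    in terms of integrals because it contains both the product rule for events
    and the multiplicativity of moments. *)
Lemma independent_copies (R : realType) (d : measure_display)
    (O : measurableType d) (P : probability O R) n (Z : 'I_n -> {RV P >-> R}) :
  exists (d' : measure_display) (O' : measurableType d')
         (P' : probability O' R) (Y : 'I_n -> {RV P' >-> R}),
    forall g : 'I_n -> R -> R, (forall i, measurable_fun setT (g i)) ->
      (forall i y, 0 <= g i y) ->
      (\int[P']_w (\prod_(i < n) g i (Y i w))%:E =
       \prod_(i < n) \int[P]_w (g i (Z i w))%:E)%E.
Proof.
elim: n Z => [|n IH] Z.
  exists d, O, P, Z => g _ _; rewrite big_ord0.
  under eq_integral do rewrite big_ord0.
  by rewrite integral_cst//= mul1e probability_setT.
have [d' [Q [P' [Y HY]]]] := IH (fun i => Z (lift ord0 i)).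
pose Y0 (i : 'I_n.+1) (w : O * Q) : R :=
  if unlift ord0 i is Some j then Y j w.2 else Z ord0 w.1.
have mY0 i : measurable_fun setT (Y0 i).
  by rewrite /Y0; case: unlift => [j|]; exact: measurableT_comp.
pose fY i := isMeasurableFun.Build _ _ _ _ _ (mY0 i).
pose Y' i : {RV (P \x P')%E >-> R} := HB.pack (Y0 i) (fY i).
exists _, (O * Q)%type, (P \x P')%E, Y' => g mg g0.
rewrite big_ord_recl -(HY (fun i => g (lift ord0 i)))//.
rewrite -(@integral_prod_tensor _ _ _ _ _ P P' (fun w => g ord0 (Z ord0 w))
  (fun w => \prod_(i < n) g (lift ord0 i) (Y i w)))//.
- apply: eq_integral => w _; congr EFin; rewrite big_ord_recl/=; congr (_ * _).
    by rewrite /Y0 unlift_none.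
  by apply: eq_bigr => i _; rewrite /Y0 liftK.
- exact: measurableT_comp.
- apply: measurable_prod => i _; exact: measurableT_comp.
- by move=> w; apply: prodr_ge0.
Qed.

Lemma powR_prod_norm (R : realType) n (y : 'I_n -> R) r :
  `|\prod_(i < n) y i| `^ r = \prod_(i < n) `|y i| `^ r.
Proof.
rewrite normr_prod; apply: (@proj2 (0 <= \prod_(i < n) `|y i|)).
apply: (big_ind2 (fun a b => 0 <= a /\ a `^ r = b)).
- by rewrite powR1.
- move=> a b c e [a0 <-] [c0 <-]; split; first exact: mulr_ge0.
  by rewrite powRM.
- by move=> i _.
Qed.

Lemma prod_indic (R : realType) (T U : Type) n (f : 'I_n -> T -> U)
    (B : 'I_n -> set U) w :
  \prod_(i < n) (\1_(B i) (f i w) : R) =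
  \1_(\bigcap_(i in [set: 'I_n]) (f i @^-1` B i)) w.
Proof.
have [wB|/existsNP[i wB]] := pselect (forall i, B i (f i w)).
  rewrite big1 => [|i _]; rewrite indicE mem_set//.
  by move=> i _; exact: wB.
rewrite (bigD1 i)//= indicE memNset// mul0r indicE memNset//.
by move=> /(_ i Logic.I).
Qed.

(** Taking indicators in [independent_copies] gives the product rule, from which
    the marginal laws follow by taking all events but one equal to [setT]. *)
Lemma independent_copies_with_laws (R : realType) (d : measure_display)
    (O : measurableType d) (P : probability O R) n (Z : 'I_n -> {RV P >-> R}) :
  exists (d' : measure_display) (O' : measurableType d')
         (P' : probability O' R) (Y : 'I_n -> {RV P' >-> R}),
    [/\ mutually_independent P' Y,
        forall i, eq_law P' (Y i) P (Z i) &
        forall r, abs_moment P' (fun w => \prod_(i < n) Y i w) r =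
                  (\prod_(i < n) abs_moment P (Z i) r)%E].
Proof.
have [d' [Q [P' [Y HY]]]] := independent_copies Z.
have mB (B : 'I_n -> set R) i : measurable (B i) -> forall d1
    (O1 : measurableType d1) (P1 : probability O1 R) (W : {RV P1 >-> R}),
    measurable (W @^-1` B i).
  by move=> mBi d1 O1 P1 W; rewrite -[X in measurable X]setTI; exact: measurable_funP.
have joint B : (forall i, measurable (B i)) ->
    P' (\bigcap_(i in [set: 'I_n]) (Y i @^-1` B i)) =
    (\prod_(i < n) P (Z i @^-1` B i))%E.
  move=> mBi; have := HY (fun i => \1_(B i)).
  under eq_integral => w _ do rewrite (prod_indic R (fun i => Y i) B w).
  rewrite integral_indic ?setIT//; last first.
    by apply: fin_bigcap_measurable => // i _; exact: mB.
  move=> ->//.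
  apply: eq_bigr => i _.
  by rewrite -[X in P X]setIT -integral_indic//; exact: mB.
have law i : eq_law P' (Y i) P (Z i).
  move=> B mBB; have := joint (fun j => if j == i then B else setT).
  rewrite (bigD1 i)//= eqxx big1 => [|j /negbTE ->]; last first.
    by rewrite preimage_setT probability_setT.
  rewrite mule1 /pushforward => <-; last by move=> j; case: ifP.
  congr (P' _); apply/seteqP; split=> [w /= wB j _ /=|w /(_ i Logic.I)/=].
    by case: eqP => [->|].
  by rewrite eqxx.
exists d', Q, P', Y; split=> // [B mBi|r].
  by rewrite joint//; apply: eq_bigr => i _; exact/esym/law.
rewrite /abs_moment; under eq_integral do rewrite powR_prod_norm.
rewrite (HY (fun _ y => `|y| `^ r))// => _.
exact: measurable_abs_powR.
Qed.

(** * Moments of the scaling factors *)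

Lemma positive_rv_eq_law (R : realType) (d1 d2 : measure_display)
    (O1 : measurableType d1) (O2 : measurableType d2)
    (P1 : probability O1 R) (P2 : probability O2 R)
    (U : {RV P1 >-> R}) (V : {RV P2 >-> R}) :
  eq_law P1 U P2 V -> positive_rv P2 V -> positive_rv P1 U.
Proof.
move=> UV V0.
have m d (O : measurableType d) (Q : probability O R) (W : {RV Q >-> R}) :
    measurable (W @^-1` `]-oo, 0]%classic).
  by rewrite -[X in measurable X]setTI; exact: measurable_funP.
have E T (W : T -> R) : ~` [set w | 0 < W w] = W @^-1` `]-oo, 0]%classic.
  by apply/seteqP; split=> w /=; rewrite in_itv/= leNgt => /negP.
suff: P1.-negligible (~` [set w | 0 < U w]) by [].
have : P2.-negligible (~` [set w | 0 < V w]) by [].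
rewrite !E => /(negligibleP P2 (m _ _ _ V)) V00; apply/negligibleP => //.
by rewrite -[LHS]/(pushforward P1 U _) UV.
Qed.

Lemma eq_law_abs_moment (R : realType) (d1 d2 : measure_display)
    (O1 : measurableType d1) (O2 : measurableType d2)
    (P1 : probability O1 R) (P2 : probability O2 R)
    (U : O1 -> R) (V : O2 -> R) r :
    measurable_fun setT U -> measurable_fun setT V ->
  eq_law P1 U P2 V -> abs_moment P1 U r = abs_moment P2 V r.
Proof.
move=> mU mV; apply: (eq_law_integral (g := fun y => `|y| `^ r)) => //.
exact: (@measurable_abs_powR _ _ _ id).
Qed.

Lemma abs_moment_ge0 (R : realType) (d : measure_display)
    (O : measurableType d) (P : probability O R) (U : O -> R) (r : R) :
  (0 <= abs_moment P U r)%E.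
Proof. by apply: integral_ge0 => w _; rewrite lee_fin powR_ge0. Qed.

Lemma abs_moment_gt0 (R : realType) (d : measure_display)
    (O : measurableType d) (P : probability O R) (U : {RV P >-> R}) (r : R) :
  r != 0 -> (0 < P [set w | U w != 0%R])%E -> (0 < abs_moment P U r)%E.
Proof.
move=> r0 U0; rewrite lt_neqAle abs_moment_ge0 andbT; apply: contraTneq U0 => /esym m0.
have mp : measurable_fun setT (fun w => (`|U w| `^ r)%:E).
  by apply/measurable_EFinP; exact: measurable_abs_powR.
have : ae_eq P setT (fun w => (`|U w| `^ r)%:E) (cst 0%E).
  apply/ae_eq_integral_abs => //; rewrite -[RHS]m0.
  by apply: eq_integral => w _ /=; rewrite ger0_norm ?powR_ge0.
move=> U00; suff -> : P [set w | U w != 0] = 0%E by rewrite ltxx.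
apply/negligibleP.
  rewrite (_ : [set _ | _] = U @^-1` (~` [set 0])); last first.
    by apply/seteqP; split=> w /= /eqP.
  rewrite -[X in measurable X]setTI; apply: measurable_funP => //.
  exact: measurableC.
apply: negligibleS U00 => w /= Uw; apply/not_implyP; split=> // -[].
by move/eqP; rewrite powR_eq0 normr_eq0 (negbTE Uw).
Qed.

(** From [x^r <= 1 + x^q] for [x >= 0]. *)
Lemma abs_moment_le (R : realType) (d : measure_display)
    (O : measurableType d) (P : probability O R) (U : O -> R) (r q : R) :
    measurable_fun setT U -> 0 < r <= q ->
  (abs_moment P U q < +oo -> abs_moment P U r < +oo)%E.
Proof.
move=> mU /andP[r0 rq] Uq; have pow1 a : (1 : R) `^ a = 1 by rewrite powR1.
apply: (@le_lt_trans _ _ (\int[P]_w (1 + `|U w| `^ q)%:E)%E).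
  apply: ge0_le_integral => //.
  - by apply/measurable_EFinP; exact: measurable_abs_powR.
  - apply/measurable_EFinP; apply: measurable_funD => //.
    exact: measurable_abs_powR.
  move=> w _; rewrite lee_fin; have [U1|U1] := leP 1 `|U w|.
    by rewrite (le_trans (ler_powR U1 rq))// lerDr.
  rewrite (@le_trans _ _ 1)//; last by rewrite lerDl powR_ge0.
  by rewrite -[leRHS](pow1 r) ge0_ler_powR ?nnegrE// ltW.
under eq_integral do rewrite EFinD.
rewrite ge0_integralD//; last first.
  by apply/measurable_EFinP; exact: measurable_abs_powR.
by rewrite integral_cst//= mul1e probability_setT lte_add_pinfty ?ltry.
Qed.

Lemma eq_fdd_marginal (R : realType) (d : measure_display)
    (O : measurableType d) (P : probability O R) (D : set R)
    (X Y : R -> O -> R) t : eq_fdd P D X Y -> D t -> eq_law P (X t) P (Y t).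
Proof.
move=> XY Dt B mB.
have := XY 1%N (fun=> t) (fun=> Dt) [set x | B (tnth x ord0)] _.
rewrite /pushforward => H.
have E (Z : R -> O -> R) :
    (fun w => [tuple Z t w | _ < 1]) @^-1` [set x | B (tnth x ord0)] =
    Z t @^-1` B.
  by apply/seteqP; split=> w /=; rewrite tnth_mktuple.
rewrite -!E; apply: H.
by rewrite -[X in measurable X]setTI; exact: measurable_tnth.
Qed.

Lemma multifractal_moment (R : realType) (d : measure_display)
    (O : measurableType d) (P : probability O R) (T Lam S : set R)
    (X : R -> {RV P >-> R}) (M : R -> R -> {RV P >-> R}) l t r :
    multifractal P T Lam S X M -> Lam l -> S t ->
  (abs_moment P (X (l * t)%R) r = abs_moment P (M l t) r * abs_moment P (X t) r)%E.
Proof.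
move=> [_ ST] /(_ l) /[apply] -[_ _ ind fdd] St.
have mMX : measurable_fun setT (fun w => M l t w * X t w).
  exact: measurable_funM.
rewrite (eq_law_abs_moment r _ mMX (eq_fdd_marginal fdd St))//.
rewrite /abs_moment; under eq_integral do rewrite normrM powRM//.
apply: (integral_independent (f := fun y => `|y| `^ r) (g := fun y => `|y| `^ r)) => //.
- exact: (@measurable_abs_powR _ _ _ id).
- exact: (@measurable_abs_powR _ _ _ id).
move=> A B mA mB; apply: ind; apply: sub_sigma_algebra.
  by exists t => //; exists A => //; rewrite setTI.
by exists t; [exact: ST|exists B => //; rewrite setTI].
Qed.

Lemma admissible_scales_closed (R : realType) (Lam S : set R) :
    admissible_scales Lam S ->
  [/\ Lam 1, forall a b, Lam a -> Lam b -> Lam (a * b),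
      forall l x, 0 <= x -> Lam l -> Lam (l `^ x) &
      forall l t, Lam l -> S t -> S (l * t)].
Proof.
move=> [HL HS]; have pow1 a : (1 : R) `^ a = 1 by rewrite powR1.
have ST l t : Lam l -> S t -> S (l * t).
  by move=> Ll St; apply: (HS l Ll); exists t.
case: HL => LE; rewrite {HS}LE in ST *; split=> //=; rewrite ?in_itv/= ?ltr01 ?lexx//.
- move=> a b; rewrite !in_itv/= => /andP[a0 a1] /andP[b0 b1].
  by rewrite mulr_gt0//= mulr_ile1// ltW.
- move=> l x x0; rewrite !in_itv/= => /andP[l0 l1].
  by rewrite powR_gt0//= -[leRHS](pow1 x) ge0_ler_powR ?nnegrE// ltW.
- move=> a b; rewrite !in_itv/= !andbT => a1 b1.
  by rewrite mulr_ege1.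
- move=> l x x0; rewrite !in_itv/= !andbT => l1.
  by rewrite -[leLHS](pow1 x) ge0_ler_powR ?nnegrE// (le_trans _ l1).
Qed.

Lemma positive_rv_prod (R : realType) (d : measure_display)
    (O : measurableType d) (P : probability O R) n (Y : 'I_n -> O -> R) :
  (forall i, positive_rv P (Y i)) ->
  positive_rv P (fun w => \prod_(i < n) Y i w).
Proof.
move=> Y0; have : \forall w \ae P, forall i, 0 < Y i w by exact: filter_forall.
by apply: filterS => w Yw; apply: prodr_gt0.
Qed.

Lemma qbar_gt0P (R : realType) (d : measure_display)
    (O : measurableType d) (P : probability O R) (T : set R) (X : R -> O -> R) :
    (0 < qbar P T X)%E ->
  exists2 q, 0 < q & forall t, T t -> (abs_moment P (X t) q < +oo)%E.
Proof.
move=> /ereal_sup_gt[_ [q [_ Hq] <-]]; rewrite lte_fin => q0.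
by exists q => // t Tt; have := Hq t Tt; rewrite unlock.
Qed.

Lemma muleI_fin_gt0 (R : realType) (a b e : \bar R) :
  (0 < e < +oo)%E -> (0 <= a)%E -> (0 <= b)%E -> (a * e = b * e)%E -> a = b.
Proof.
case: e => [e| |]; rewrite ?ltxx ?andbF// => /andP[]; rewrite lte_fin => e0 _.
have e00 := gt_eqF e0.
case: a => [a| |]// _; case: b => [b| |]// _.
- by rewrite -!EFinM => -[/(mulIf (negbT e00)) ->].
- by rewrite -EFinM gt0_mulye ?lte_fin.
- by rewrite -EFinM gt0_mulye ?lte_fin.
Qed.

(** The multiplicativity of [m] compares [X(a b t0)] with [X(t0)] directly and
    through [X(b t0)]; the factor [E|X(t0)|^r], finite and nonzero, cancels. *)
Lemma scaling_moments (R : realType) (d : measure_display)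
    (O : measurableType d) (P : probability O R) (T Lam S : set R)
    (X : R -> {RV P >-> R}) (M : R -> R -> {RV P >-> R}) :
    admissible_scales Lam S -> multifractal P T Lam S X M ->
    (exists2 t, S t & (0 < P [set w | X t w != 0%R])%E) ->
    (0 < qbar P T X)%E ->
  exists2 q, 0 < q & forall r, 0 < r < q ->
    exists2 m : R -> \bar R,
      forall l t, Lam l -> S t -> abs_moment P (M l t) r = m l &
      [/\ m 1 = 1%E, forall a b, Lam a -> Lam b -> m (a * b) = (m a * m b)%E &
          forall l, Lam l -> (m l < +oo)%E].
Proof.
move=> hL hM [t0 St0 X0] /qbar_gt0P[q q0 Xq].
have [L1 Lmul _ SL] := admissible_scales_closed hL.
have [_ ST laws] := hM.
exists q => // r /andP[r0 rq].
have Xr t : S t -> (abs_moment P (X t) r < +oo)%E.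
  move=> St; apply: (abs_moment_le (q := q)) => //; first by rewrite r0 ltW.
  exact/Xq/ST.
have mX := multifractal_moment r hM.
pose e := abs_moment P (X t0) r.
have e0 : (0 < e < +oo)%E.
  by rewrite Xr// andbT abs_moment_gt0// gt_eqF.
have mE l s t : Lam l -> S s -> S t ->
    abs_moment P (M l s) r = abs_moment P (M l t) r.
  by move=> Ll Ss St; have [eqM _ _ _] := laws l Ll; apply: eq_law_abs_moment => //; exact: eqM.
exists (fun l => abs_moment P (M l t0) r); first by move=> l t Ll St; exact: mE.
split.
- apply: (muleI_fin_gt0 e0) => //; first exact: abs_moment_ge0.
  by rewrite -mX// mul1r mul1e.
- move=> a b La Lb; apply: (muleI_fin_gt0 e0); first exact: abs_moment_ge0.
    by rewrite mule_ge0// abs_moment_ge0.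
  rewrite -mX//; last exact: Lmul.
  rewrite -mulrA mX//; last exact: SL.
  by rewrite mX// muleA (mE _ _ t0)//; exact: SL.
- move=> l Ll; have := Xr _ (SL _ _ Ll St0); rewrite mX// -/e.
  rewrite !ltey; apply: contraNneq => ->.
  by rewrite gt0_mulye//; case/andP: e0.
Qed.

Theorem proposition3p1 (R : realType) (d : measure_display)
    (O : measurableType d) (P : probability O R) (T Lam S : set R)
    (X : R -> {RV P >-> R}) (M : R -> R -> {RV P >-> R})
    (hT : time_set T)
    (hX : not_identically_null P T X)
    (hScales : admissible_scales Lam S)
    (hM : multifractal P T Lam S X M)
    (* if X were null on S, its scaling relation would not constrain M at all *)
    (hXS : exists2 t, S t & (0 < P [set w | X t w != 0%R])%E)
    (hq : (0 < qbar P T X)%E) :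
  [/\ forall t, S t -> \forall w \ae P, M 1 t w = 1,
      forall l1 l2 t, Lam l1 -> Lam l2 -> S t ->
        exists (d' : measure_display) (O' : measurableType d')
               (P' : probability O' R) (M1 M2 : {RV P' >-> R}),
          [/\ independent_pair P' M1 M2,
              eq_law P' M1 P (M l1 (l2 * t)),
              eq_law P' M2 P (M l2 t) &
              eq_law P (M (l1 * l2) t) P' (fun w => M1 w * M2 w)] &
      forall l t, Lam l -> S t -> forall n : nat, (0 < n)%N ->
        exists (d' : measure_display) (O' : measurableType d')
               (P' : probability O' R) (Y : 'I_n -> {RV P' >-> R}),
          [/\ iid P' Y,
              forall i, positive_rv P' (Y i),
              eq_law P (M l t) P' (fun w => \prod_(i < n) Y i w) &
              forall i, eq_law P' (Y i) P (M (l `^ n%:R^-1) t)]].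
Proof.
have [L1 Lmul Lpow SL] := admissible_scales_closed hScales.
have [q q0 mom] := scaling_moments hScales hM hXS hq.
have [LamP _ laws] := hM.
have Mpos l t : Lam l -> S t -> positive_rv P (M l t).
  by move=> Ll St; have [_ /(_ t St)] := laws l Ll.
split.
- move=> t St.
  have /(_ [set 1] (measurable_set1 1)) : eq_law P (M 1 t) P (cst 1).
    apply: (eq_law_of_moments (q := q)) => //.
    + exact: Mpos.
    + by apply: aeW => w; exact: ltr01.
    (* both laws have all moments of order below [q] equal to 1 *)
    move=> r /mom[m mM [m1 _ mfin]]; rewrite mM// m1 ltry; split=> //.
    rewrite /abs_moment; under eq_integral do rewrite /= normr1 powR1.
    by rewrite integral_cst//= mul1e probability_setT.
  rewrite /pushforward preimage_cst ifT ?inE// probability_setT => M1.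
  have mM1 : measurable (M 1 t @^-1` [set 1]).
    by rewrite -[X in measurable X]setTI; exact: measurable_funP.
  apply/(negligibleP P (measurableC mM1)).
  by rewrite /= probability_setC// M1 subee.
- move=> l1 l2 t L1' L2' St.
  pose Z (i : 'I_2) := if i == ord0 then M l1 (l2 * t) else M l2 t.
  have [d' [Q [P' [Y [ind law mY]]]]] := independent_copies_with_laws Z.
  pose i1 : 'I_2 := lift ord0 ord0.
  have Zpos i : positive_rv P (Z i).
    by rewrite /Z; case: ifP => _; apply: Mpos => //; exact: SL.
  exists d', Q, P', (Y ord0), (Y i1).
  have prodE w : \prod_(i < 2) Y i w = Y ord0 w * Y i1 w.
    by rewrite !big_ord_recl big_ord0 mulr1.
  split; [|exact: (law ord0)|exact: (law i1)|].
  + move=> _ _ [A mA <-] [B mB <-]; rewrite !setTI.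
    have := ind (fun i => if i == ord0 then A else B) _.
    rewrite !big_ord_recl big_ord0 mule1/= => <-; last by move=> i; case: ifP.
    congr (P' _); apply/seteqP; split=> [w [wA wB] i _/=|w wAB].
      case: ifPn => [/eqP -> //|].
      by case: i => -[|[|//]] //= h _; rewrite (_ : Ordinal h = i1)//; exact/val_inj.
    by split; [exact: (wAB ord0)|exact: (wAB i1)].
  have -> : (fun w => Y ord0 w * Y i1 w) = (fun w => \prod_(i < 2) Y i w).
    by apply/funext => w; rewrite prodE.
  apply: (eq_law_of_moments (q := q)) => //.
  + by apply: measurable_prod => i _.
  + by apply: Mpos => //; exact: Lmul.
  + by apply: positive_rv_prod => i; exact: positive_rv_eq_law (law i) (Zpos i).
  move=> r /mom[m mM [_ mmul mfin]]; rewrite mY mM ?mmul//; last exact: Lmul.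
  rewrite !big_ord_recl big_ord0 mule1/= !mM//; last exact: SL.
  by split=> //; rewrite -mmul//; exact/mfin/Lmul.
- move=> l t Ll St n n0.
  pose k := l `^ n%:R^-1.
  have Lk : Lam k by exact: Lpow.
  have l0 : 0 < l by have := LamP l Ll; rewrite /= in_itv/= andbT.
  have kn : k ^+ n = l.
    rewrite -powR_mulrn ?powR_ge0// /k -powRrM mulVf ?powRr1 ?ltW//.
    by rewrite pnatr_eq0 -lt0n.
  have [d' [Q [P' [Y [ind law mY]]]]] := independent_copies_with_laws (fun _ : 'I_n => M k t).
  have Ypos i : positive_rv P' (Y i) by exact: positive_rv_eq_law (law i) (Mpos _ _ Lk St).
  exists d', Q, P', Y; split=> //.
    by split=> // i j B mB; exact: etrans (law i B mB) (esym (law j B mB)).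
  apply: (eq_law_of_moments (q := q)) => //.
  + by apply: measurable_prod => i _.
  + exact: Mpos.
  + exact: positive_rv_prod.
  move=> r /mom[m mM [m1 mmul mfin]]; rewrite mY !mM//; split; last exact: mfin.
  suff : Lam (k ^+ n) /\ m (k ^+ n) = (\prod_(i < n) m k)%E by rewrite kn => -[].
  elim: (n) => [|j [Lj mj]]; first by rewrite expr0 big_ord0.
  by rewrite exprS big_ord_recl mmul// mj; split=> //; exact: Lmul.
Qed.
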